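(* Let $A,B,C$ be the vertices of a non-degenerate triangle in the Euclidean plane. Let $D'$ be the intersection of the perpendicular bisector of $AB$ with the line through $A$ perpendicular to $CA$; let $E'$ be the intersection of the perpendicular bisector of $BC$ with the line through $B$ perpendicular to $AB$; and let $F'$ be the intersection of the perpendicular bisector of $CA$ with the line through $C$ perpendicular to $BC$. Let $D$ be the intersection of the line through $B$ perpendicular to $AC$ with the perpendicular bisector of $AB$; let $E$ be the intersection of the line through $C$ perpendicular to $AB$ with the perpendicular bisector of $BC$; and let $F$ be the intersection of the line through $A$ perpendicular to $BC$ with the perpendicular bisector of $AC$. Then $\triangle D'E'F'$ and $\triangle ABC$ are similar, and the area of $\triangle D'E'F'$ is equal to the sum of the area of $\triangle ABC$ and the area of $\triangle DEF$.
   Context: Similarity of triangles is with vertices corresponding in the order written ($D'\leftrightarrow A$, $E'\leftrightarrow B$, $F'\leftrightarrow C$). Areas are unsigned; when $\triangle ABC$ is equilateral, $\triangle DEF$ degenerates to a single point and its area is $0$. *)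

(* Defs.v *)
From mathcomp Require Import all_boot all_order all_algebra.
From mathcomp Require Import all_classical all_reals all_analysis.
From mathcomp Require Import ring lra.

Set Implicit Arguments.
Unset Strict Implicit.
Unset Printing Implicit Defensive.

Import Order.TTheory GRing.Theory Num.Theory.

Local Open Scope classical_set_scope.
Local Open Scope ring_scope.

Section EuclideanPlane.
Context {R : realType}.
Implicit Types (A B C D P Q X u v : 'rV[R]_2).

Definition dot u v : R := (u *m v^T) 0 0.

(* The norm that mathcomp-analysis puts on 'rV[R]_2 is the sup norm, so
   Euclidean distances are defined from the dot product. *)
Definition dist P Q : R := Num.sqrt (dot (Q - P) (Q - P)).

(* Unsigned angle at the vertex Q, in [0, pi]; meaningful only for
   P != Q and X != Q. *)
Definition angle P Q X : R :=
  acos (dot (P - Q) (X - Q) / (dist Q P * dist Q X)).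

Definition midpoint P Q : 'rV[R]_2 := 2^-1 *: (P + Q).

(* The line through X perpendicular to the line PQ (a line when P != Q). *)
Definition perp_line X P Q : set 'rV[R]_2 :=
  [set Y | dot (Y - X) (Q - P) = 0].

Definition perp_bisector P Q : set 'rV[R]_2 := perp_line (midpoint P Q) P Q.

(* The vectors AB and AC are linearly independent. *)
Definition nondegenerate_triangle A B C : bool :=
  row_free (col_mx (B - A) (C - A)).

(* Unsigned area; it vanishes for collinear points, in particular for
   a triangle reduced to a point. *)
Definition triangle_area A B C : R := `|\det (col_mx (B - A) (C - A))| / 2.

(* A corresponds to A', B to B' and C to C'. Since k > 0, the two triangles
   are degenerate or non-degenerate together. *)
Definition similar_triangles A B C A' B' C' : Prop :=
  [/\ angle B A C = angle B' A' C',
      angle A B C = angle A' B' C',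
      angle B C A = angle B' C' A' &
      exists2 k : R, 0 < k &
        [/\ dist A B = k * dist A' B',
            dist B C = k * dist B' C' &
            dist C A = k * dist C' A']].

Lemma dotE u v : dot u v = u 0 0 * v 0 0 + u 0 1 * v 0 1.
Proof.
rewrite /dot mxE !big_ord_recl big_ord0 addr0 !mxE.
by have -> : lift ord0 ord0 = 1 :> 'I_2 by apply/val_inj.
Qed.

Lemma det_col_mxE u v :
  \det (col_mx u v) = u 0 0 * v 0 1 - u 0 1 * v 0 0.
Proof.
rewrite (expand_det_row _ (lshift 1 (0 : 'I_1))).
rewrite !big_ord_recl big_ord0 addr0 /cofactor !det_mx11 !mxE /=.
have -> : lift (lshift 1 (0 : 'I_1)) (0 : 'I_1) = rshift 1 (0 : 'I_1).
  exact/val_inj.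
rewrite (unsplitK (inl (0 : 'I_1))) (unsplitK (inr (0 : 'I_1))).
have -> : lift (lift ord0 ord0) 0 = 0 :> 'I_2 by exact/val_inj.
have -> : lift ord0 0 = 1 :> 'I_2 by exact/val_inj.
rewrite (_ : ord0 = 0) //= /bump /= !addn0 expr0 expr1; ring.
Qed.

Lemma nondegenerate_triangleE A B C :
  nondegenerate_triangle A B C = (\det (col_mx (B - A) (C - A)) != 0).
Proof. by rewrite /nondegenerate_triangle row_free_unit unitmxE unitfE. Qed.

(* Perpendiculars to two non-parallel lines meet in exactly one point. *)
Lemma perp_line_meet X Y P Q P' Q' :
  \det (col_mx (Q - P) (Q' - P')) != 0 ->
  exists Z, perp_line X P Q `&` perp_line Y P' Q' = [set Z].
Proof.
rewrite /perp_line det_col_mxE; move: (Q - P) (Q' - P') => u v d0.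
have subE (S T : 'rV[R]_2) (i : 'I_2) : (S - T) 0 i = S 0 i - T 0 i.
  by rewrite !mxE.
have [a aE] : exists a, a = dot X u by eexists.
have [b bE] : exists b, b = dot Y v by eexists.
have [d dE] : exists d, d = u 0 0 * v 0 1 - u 0 1 * v 0 0 by eexists.
rewrite -dE in d0; rewrite !dotE in aE bE.
pose z0 := (a * v 0 1 - b * u 0 1) / d; pose z1 := (b * u 0 0 - a * v 0 0) / d.
exists (\row_i (if i == 0 then z0 else z1)).
apply/seteqP; split => W /=; rewrite !dotE !subE.
- move=> [h1 h2].
  have {h1}ha : a = W 0 0 * u 0 0 + W 0 1 * u 0 1.
    by apply/eqP; rewrite -subr_eq0 -oppr_eq0 -h1 aE; apply/eqP; ring.
  have {h2}hb : b = W 0 0 * v 0 0 + W 0 1 * v 0 1.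
    by apply/eqP; rewrite -subr_eq0 -oppr_eq0 -h2 bE; apply/eqP; ring.
  apply/rowP => i; rewrite mxE; apply: (mulIf d0).
  have [->|->] : i = 0 \/ i = 1.
    by case: i => [[|[|//]] ?]; [left|right]; apply/val_inj.
  + by rewrite eqxx divfK // dE ha hb; ring.
  + by rewrite /= divfK // dE ha hb; ring.
- move=> ->; rewrite !mxE /=.
  have z0d : z0 * d = a * v 0 1 - b * u 0 1 by rewrite divfK.
  have z1d : z1 * d = b * u 0 0 - a * v 0 0 by rewrite divfK.
  split; apply: (mulIf d0); rewrite mul0r.
  + rewrite (_ : _ * d = z0 * d * u 0 0 + z1 * d * u 0 1 - a * d); last first.
      by rewrite aE; ring.
    by rewrite z0d z1d dE; ring.
  + rewrite (_ : _ * d = z0 * d * v 0 0 + z1 * d * v 0 1 - b * d); last first.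
      by rewrite bE; ring.
    by rewrite z0d z1d dE; ring.
Qed.

(* H is the foot of the altitude from C: the area is half base times height. *)
Lemma triangle_area_base_height A B C H (t : R) :
  H = A + t *: (B - A) -> perp_line H A B C ->
  triangle_area A B C = dist A B * dist H C / 2.
Proof.
rewrite /perp_line /triangle_area /dist /= => HE hu; congr (_ * _); move: hu.
rewrite det_col_mxE; have -> : C - A = (C - H) + t *: (B - A).
  by rewrite HE opprD addrA subrK.
move: (B - A) (C - H) => u w; rewrite -sqrtrM; last first.
  by rewrite dotE -!expr2 addr_ge0 ?sqr_ge0.
rewrite -sqrtr_sqr !dotE !mxE => uw0; congr Num.sqrt.
have -> : u 0 0 * (w 0 1 + t * u 0 1) - u 0 1 * (w 0 0 + t * u 0 0) =
          u 0 0 * w 0 1 - u 0 1 * w 0 0 by ring.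
apply/eqP; rewrite -subr_eq0 -oppr_eq0; apply/eqP.
transitivity ((w 0 0 * u 0 0 + w 0 1 * u 0 1) ^+ 2); first by ring.
by rewrite uw0 expr0n.
Qed.

End EuclideanPlane.

(* Main.v *)
Require Import Defs.
From mathcomp Require Import all_boot all_order all_algebra.
From mathcomp Require Import all_classical all_reals all_analysis.
From mathcomp Require Import ring.

Import Order.TTheory GRing.Theory Num.Theory.

Local Open Scope classical_set_scope.
Local Open Scope ring_scope.

(** Write [u = B - A], [v = C - A], let [d] be their determinant, [S] the sum
    of the squares of the three sides, and let [rot] be the rotation by a right
    angle.  The point [D'] is the apex of an isosceles triangle of base [AB]
    whose leg [AD'] is orthogonal to [CA], so that
    [D' = A + |AB|^2 / (2 d) rot (A - C)]; the points [E'] and [F'] are obtained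
    by cycling [A, B, C], with the same [d].  Subtracting these formulas shows
    that each side of [D'E'F'] is the image of the corresponding side of [ABC]
    under multiplication by the one complex number [w = 1/2 + i q], where
    [q = S / (4 d)]: this is [brocard_side].  Hence [D'E'F'] is directly similar
    to [ABC] with ratio [|w|], and its signed area is [|w|^2] times that of
    [ABC] ([similar_spiral], [det_spiral]).

    The point symmetry about the midpoint of [AB] exchanges the lines through
    [A] and [B] perpendicular to [CA] and preserves the bisector of [AB], hence
    [D = A + B - D'] ([meet_reflect]); similarly for [E] and [F].  So
    [E - D = v - w u] and [F - D = (v - u) - w v], and expanding the determinant
    shows that the signed area of [DEF] is [1 - |w|^2] times that of [ABC]
    ([det_reflected]).

    Finally [|w| >= 1], because this says [S^2 >= 12 d^2], which is
    Weitzenboeck's inequality ([weitzenboeck]).  The unsigned area of [DEF] is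
    therefore [|w|^2 - 1] times that of [ABC], and the areas add up. *)

Section Plane.
Context {R : realType}.
Implicit Types (A B C D P Q X Y u v w : 'rV[R]_2) (p q : R).

Local Notation cross u v := (\det (col_mx u v)).

Lemma row2P u v : u 0 0 = v 0 0 -> u 0 1 = v 0 1 -> u = v.
Proof.
move=> e0 e1; apply/rowP => i.
by have [->|->] : i = 0 \/ i = 1
  by case: i => [[|[|//]] ?]; [left|right]; apply/val_inj.
Qed.

(** * Rotations and complex multiplication *)

Definition rot u : 'rV[R]_2 := \row_i (if i == 0 then - u 0 1 else u 0 0).

(** Multiplication by the complex number [p + i q]. *)
Definition spiral p q u : 'rV[R]_2 := p *: u + q *: rot u.

Lemma spiralB p q u v : spiral p q (u - v) = spiral p q u - spiral p q v.
Proof. by apply: row2P; rewrite !mxE /=; ring. Qed.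

Lemma spiralN p q u : spiral p q (- u) = - spiral p q u.
Proof. by apply: row2P; rewrite !mxE /=; ring. Qed.

Lemma dot_spiral p q u v :
  dot (spiral p q u) (spiral p q v) = (p ^+ 2 + q ^+ 2) * dot u v.
Proof. by rewrite !dotE !mxE /=; ring. Qed.

Lemma det_spiral p q u v :
  cross (spiral p q u) (spiral p q v) = (p ^+ 2 + q ^+ 2) * cross u v.
Proof. by rewrite !det_col_mxE !mxE /=; ring. Qed.

Lemma dist_spiral p q P Q P' Q' : Q' - P' = spiral p q (Q - P) ->
  dist P' Q' = Num.sqrt (p ^+ 2 + q ^+ 2) * dist P Q.
Proof.
by move=> e; rewrite /dist e dot_spiral sqrtrM // addr_ge0 ?sqr_ge0.
Qed.

Lemma angle_spiral p q P Q X P' Q' X' : 0 < p ^+ 2 + q ^+ 2 ->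
  P' - Q' = spiral p q (P - Q) -> X' - Q' = spiral p q (X - Q) ->
  angle P' Q' X' = angle P Q X.
Proof.
move=> n0 eP eX.
rewrite /angle (dist_spiral _ _ _ _ _ _ eP) (dist_spiral _ _ _ _ _ _ eX).
rewrite eP eX dot_spiral mulrACA -expr2 sqr_sqrtr ?ltW //.
by rewrite -mulf_div divff ?gt_eqF // mul1r.
Qed.

Lemma similar_spiral p q A B C A' B' C' : 0 < p ^+ 2 + q ^+ 2 ->
  B' - A' = spiral p q (B - A) -> C' - A' = spiral p q (C - A) ->
  similar_triangles A' B' C' A B C.
Proof.
move=> n0 eB eC.
have eBC : C' - B' = spiral p q (C - B).
  have sub X Y Z : X - Y = (X - Z) - (Y - Z) by rewrite opprB addrA subrK.
  by rewrite (sub C' B' A') (sub C B A) spiralB eB eC.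
have opp P Q P' Q' :
    Q' - P' = spiral p q (Q - P) -> P' - Q' = spiral p q (P - Q).
  by move=> e; rewrite -opprB e -spiralN opprB.
split; [by apply: (angle_spiral p q) => //; apply: opp..|].
exists (Num.sqrt (p ^+ 2 + q ^+ 2)); first by rewrite sqrtr_gt0.
by split; apply: dist_spiral => //; apply: opp.
Qed.

(** * The points of the construction *)

Lemma perp_lineC X P Q : perp_line X P Q = perp_line X Q P.
Proof.
by apply/seteqP; split=> Y /=; rewrite /perp_line /= !dotE !mxE => h;
   apply: oppr_inj; rewrite oppr0 -h; ring.
Qed.

Lemma perp_bisectorC P Q : perp_bisector P Q = perp_bisector Q P.
Proof. by rewrite /perp_bisector perp_lineC /midpoint addrC. Qed.

(** The point symmetry about the midpoint of [PQ] preserves the bisector of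
    [PQ] and exchanges the parallel lines through [P] and [Q], so it carries the
    one intersection point to the other. *)
Lemma meet_reflect P Q X Y Z Z' :
  perp_bisector P Q `&` perp_line P X Y = [set Z'] ->
  perp_line Q X Y `&` perp_bisector P Q = [set Z] ->
  Z = P + Q - Z'.
Proof.
move=> hZ' hZ.
suff : (perp_bisector P Q `&` perp_line P X Y) (P + Q - Z).
  by rewrite hZ' => <-; rewrite opprB addrC subrK.
have [] : (perp_line Q X Y `&` perp_bisector P Q) Z by rewrite hZ.
rewrite /perp_bisector /perp_line /midpoint /= !dotE !mxE => h1 h2.
split; apply: oppr_inj; rewrite oppr0; last by rewrite -h1; ring.
by rewrite -h2; field.
Qed.

Lemma orthogonal_rot u v w : cross v u != 0 -> dot w v = 0 ->
  w = (dot w u / cross v u) *: rot v.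
Proof.
move=> d0 h; apply: row2P; apply: (mulIf d0);
  rewrite !mxE mulrAC divfK //= !dotE det_col_mxE in h *; apply/eqP;
  rewrite -subr_eq0.
  by rewrite -[X in _ == X](mulr0 (u 0 1)) -h; apply/eqP; ring.
by rewrite -[X in _ == X](mulr0 (- u 0 0)) -h; apply/eqP; ring.
Qed.

(** The vector [Y - P] is a multiple of [rot (Z - X)]; since [Y] is equidistant
    from [P] and [Q], its inner product with [Q - P] is half of the squared
    length of [PQ], and this determines the factor. *)
Lemma isosceles_apex P Q X Z Y : cross (Z - X) (Q - P) != 0 ->
  perp_bisector P Q Y -> perp_line P X Z Y ->
  Y = P + (dot (Q - P) (Q - P) / 2 / cross (Z - X) (Q - P)) *: rot (Z - X).
Proof.
move=> d0 hb hl.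
suff <- : dot (Y - P) (Q - P) = dot (Q - P) (Q - P) / 2.
  by rewrite -orthogonal_rot // addrC subrK.
move: hb; rewrite /perp_bisector /perp_line /midpoint /= !dotE !mxE => hb.
by apply/eqP; rewrite -subr_eq0 -hb; apply/eqP; field.
Qed.

(** * The similarity factor *)

Lemma cross_cycle A B C : cross (C - B) (A - B) = cross (B - A) (C - A).
Proof. by rewrite !det_col_mxE !mxE; ring. Qed.

(** Half of the cotangent of the Brocard angle of the triangle, negative when
    the triangle is negatively oriented. *)
Definition half_cot_brocard A B C : R :=
  (dot (B - A) (B - A) + dot (C - B) (C - B) + dot (A - C) (A - C))
  / (4 * cross (B - A) (C - A)).

Lemma half_cot_brocard_cycle A B C :
  half_cot_brocard B C A = half_cot_brocard A B C.
Proof.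
by rewrite /half_cot_brocard cross_cycle; congr (_ / _); rewrite addrC addrA.
Qed.

(** Since [rot (A - C)] is a combination of [B - A] and [rot (B - A)], so is
    [Y - X]; the law of cosines makes its coefficients symmetric in [A, B, C]. *)
Lemma brocard_side A B C X Y : cross (B - A) (C - A) != 0 ->
  perp_bisector A B X -> perp_line A C A X ->
  perp_bisector B C Y -> perp_line B A B Y ->
  Y - X = spiral 2^-1 (half_cot_brocard A B C) (B - A).
Proof.
move=> d0 bX lX bY lY.
have dX : cross (A - C) (B - A) = cross (B - A) (C - A).
  by rewrite !det_col_mxE !mxE; ring.
have dY : cross (B - A) (C - B) = cross (B - A) (C - A).
  by rewrite !det_col_mxE !mxE; ring.
rewrite (isosceles_apex _ _ _ _ _ _ bX lX) ?dX //.
rewrite (isosceles_apex _ _ _ _ _ _ bY lY) ?dY //.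
rewrite /half_cot_brocard; move: d0.
rewrite !det_col_mxE !dotE !mxE => d0.
by apply: row2P; rewrite !mxE /=; field.
Qed.

(** With [x], [y] the squares of two sides and [p] the inner product of the
    corresponding vectors, so that [d^2 = x y - p^2], the difference of the two
    members of [S^2 >= 12 d^2] is [(4 p - (x + y))^2 + 3 (x - y)^2]. *)
Lemma weitzenboeck A B C : cross (B - A) (C - A) != 0 ->
  1 <= 2^-1 ^+ 2 + half_cot_brocard A B C ^+ 2.
Proof.
rewrite /half_cot_brocard => d0.
have -> : dot (B - A) (B - A) + dot (C - B) (C - B) + dot (A - C) (A - C) =
    2 * (dot (B - A) (B - A) + dot (C - A) (C - A) - dot (B - A) (C - A)).
  by rewrite !dotE !mxE; ring.
move: (B - A) (C - A) d0 => u v d0; rewrite -subr_ge0.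
have lagrange : cross u v ^+ 2 = dot u u * dot v v - dot u v ^+ 2.
  by rewrite det_col_mxE !dotE; ring.
suff -> : 2^-1 ^+ 2
    + (2 * (dot u u + dot v v - dot u v) / (4 * cross u v)) ^+ 2 - 1 =
    ((4 * dot u v - (dot u u + dot v v)) ^+ 2 + 3 * (dot u u - dot v v) ^+ 2)
    / (16 * cross u v ^+ 2).
  by rewrite divr_ge0 ?addr_ge0 ?sqr_ge0 //; apply: mulr_ge0; rewrite ?sqr_ge0.
have l0 : cross u v ^+ 2 != 0 by rewrite expf_neq0.
rewrite !exprMn !exprVn !exprMn.
rewrite lagrange in l0 *; field; exact: l0.
Qed.

(** The determinant of [v - w u] and [(v - u) - w v], where [u = B - A],
    [v = C - A] and [w = 1/2 + i q].  Its part linear in [w] is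
    [- d / 2 - q S / 2], which is [- d / 2 - 2 q^2 d] for the value of [q]
    considered here. *)
Lemma det_reflected A B C : cross (B - A) (C - A) != 0 ->
  let w := spiral 2^-1 (half_cot_brocard A B C) in
  cross ((C - A) - w (B - A)) ((C - B) - w (C - A)) =
  (1 - (2^-1 ^+ 2 + half_cot_brocard A B C ^+ 2)) * cross (B - A) (C - A).
Proof.
rewrite /half_cot_brocard !det_col_mxE !dotE !mxE /= => d0.
by field.
Qed.

End Plane.

Theorem mainTheorem2 (R : realType)
    (A B C D E F D' E' F' : 'rV[R]_2)
    (hABC : nondegenerate_triangle A B C)
    (hD' : perp_bisector A B `&` perp_line A C A = [set D'])
    (hE' : perp_bisector B C `&` perp_line B A B = [set E'])
    (hF' : perp_bisector C A `&` perp_line C B C = [set F'])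
    (hD : perp_line B A C `&` perp_bisector A B = [set D])
    (hE : perp_line C A B `&` perp_bisector B C = [set E])
    (hF : perp_line A B C `&` perp_bisector A C = [set F]) :
  similar_triangles D' E' F' A B C /\
  triangle_area D' E' F' = triangle_area A B C + triangle_area D E F.
Proof.
rewrite nondegenerate_triangleE in hABC.
have [bD' lD'] : (perp_bisector A B `&` perp_line A C A) D' by rewrite hD'.
have [bE' lE'] : (perp_bisector B C `&` perp_line B A B) E' by rewrite hE'.
have [bF' lF'] : (perp_bisector C A `&` perp_line C B C) F' by rewrite hF'.
pose q := half_cot_brocard A B C.
have eE : E' - D' = spiral 2^-1 q (B - A) by apply: (brocard_side A B C).
have eF : F' - D' = spiral 2^-1 q (C - A).
  rewrite -opprB -[C - A]opprB spiralN; congr (- _).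
  rewrite /q -2!half_cot_brocard_cycle; apply: (brocard_side C A B) => //.
  by rewrite 2!cross_cycle.
have n1 : 1 <= 2^-1 ^+ 2 + q ^+ 2 by exact: weitzenboeck.
have n0 : 0 < 2^-1 ^+ 2 + q ^+ 2 by exact: lt_le_trans n1.
split; first exact: similar_spiral n0 eE eF.
rewrite perp_lineC in hD; rewrite perp_bisectorC in hF.
have ED : E - D = (C - A) - spiral 2^-1 q (B - A).
  rewrite (meet_reflect _ _ _ _ _ _ hE' hE) (meet_reflect _ _ _ _ _ _ hD' hD).
  by rewrite -eE; apply: row2P; rewrite !mxE; ring.
have FD : F - D = (C - B) - spiral 2^-1 q (C - A).
  rewrite (meet_reflect _ _ _ _ _ _ hF' hF) (meet_reflect _ _ _ _ _ _ hD' hD).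
  by rewrite -eF; apply: row2P; rewrite !mxE; ring.
rewrite /triangle_area eE eF det_spiral ED FD det_reflected // -/q !normrM.
by rewrite (ger0_norm (ltW n0)) (ler0_norm (x := 1 - _)) ?subr_le0 //; ring.
Qed.
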